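(* Given $k\in[n-1]$, let $T$ be either a Coxeter word (a product of all toggles $\tau_{i,j}$, $1\le i<j\le n$, each used exactly once, in some order), or a partial Coxeter word (a product of pairwise distinct toggles) that contains $\tau_{k,k+1}$. Then the statistic $\psi_k:\mathrm{NC}(n)\to\mathbb{Z}$ is $1$-mesic on orbits of $T$.
   Context: Let $[n]=\{1,\dots,n\}$. An arc is a pair $(i,j)$ with $1\le i<j\le n$. A noncrossing partition of $[n]$ is identified with the set $P$ of arcs $(i,j)$ such that $i,j$ are in the same block and none of $i+1,\dots,j-1$ is in that block. Equivalently, $\mathrm{NC}(n)$ is the set of all sets $P$ of arcs containing no two distinct arcs $(i,j),(k,\ell)$ that (in some order) are crossing ($i<k<j<\ell$), left-nesting ($i=k<j<\ell$) or right-nesting ($i<k<j=\ell$). For an arc $(i,j)$, the toggle $\tau_{i,j}:\mathrm{NC}(n)\to\mathrm{NC}(n)$ is defined by $\tau_{i,j}(P)=P\setminus\{(i,j)\}$ if $(i,j)\in P$; $\tau_{i,j}(P)=P\cup\{(i,j)\}$ if $(i,j)\notin P$ and $P\cup\{(i,j)\}\in\mathrm{NC}(n)$; and $\tau_{i,j}(P)=P$ otherwise. Products of toggles are compositions of maps performed right to left. Let $\chi_{i,j}(P)=1$ if $(i,j)\in P$ and $0$ otherwise. For $k\in[n-1]$ define $$\psi_k(P)=2\chi_{k,k+1}(P)+\sum_{1\le i\le k-1}\chi_{i,k+1}(P)+\sum_{k+2\le j\le n}\chi_{k,j}(P).$$ A statistic $f$ on a finite set $X$ is $c$-mesic on orbits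 of a bijection $T:X\to X$ if for every $T$-orbit $\mathcal{O}$ one has $\frac{1}{\#\mathcal{O}}\sum_{x\in\mathcal{O}}f(x)=c$. *)

(* Defs.v *)
From HB Require Import structures.
From mathcomp Require Import all_boot all_order all_algebra all_fingroup.

Set Implicit Arguments.
Unset Strict Implicit.
Unset Printing Implicit Defensive.

Import GRing.Theory.

(* The ground set [n] = {1, ..., n} is represented by 'I_n = {0, ..., n-1}:
   everything below only depends on the order and on successors. *)

Definition is_arc n (a : 'I_n * 'I_n) : bool := a.1 < a.2.

Definition crossing n (a b : 'I_n * 'I_n) : bool :=
  [&& a.1 < b.1, b.1 < a.2 & a.2 < b.2].

Definition left_nesting n (a b : 'I_n * 'I_n) : bool :=
  [&& a.1 == b.1, b.1 < a.2 & a.2 < b.2].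

Definition right_nesting n (a b : 'I_n * 'I_n) : bool :=
  [&& a.1 < b.1, b.1 < a.2 & a.2 == b.2].

(* The two arcs range over all ordered pairs, which accounts for
   "in some order". *)
Definition noncrossing n (P : {set 'I_n * 'I_n}) : bool :=
  [forall a in P, is_arc a] &&
  [forall a in P, forall b in P, (a != b) ==>
     ~~ [|| crossing a b, left_nesting a b | right_nesting a b]].

Definition NC n := {P : {set 'I_n * 'I_n} | noncrossing P}.

Definition toggle_set n (a : 'I_n * 'I_n) (P : {set 'I_n * 'I_n}) :
    {set 'I_n * 'I_n} :=
  if a \in P then P :\ a
  else if noncrossing (a |: P) then a |: P
  else P.

Lemma noncrossingS n (P Q : {set 'I_n * 'I_n}) :
  P \subset Q -> noncrossing Q -> noncrossing P.
Proof.
move=> /subsetP sPQ /andP[/forall_inP arcQ /forall_inP ncQ].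
apply/andP; split; first by apply/forall_inP => a /sPQ; apply: arcQ.
apply/forall_inP => a /sPQ /ncQ /forall_inP ncQa.
by apply/forall_inP => b /sPQ; apply: ncQa.
Qed.

Lemma toggle_set_noncrossing n a (P : {set 'I_n * 'I_n}) :
  noncrossing P -> noncrossing (toggle_set a P).
Proof.
rewrite /toggle_set => ncP; case: ifP => _.
  exact: noncrossingS (subD1set P a) ncP.
by case: ifP.
Qed.

(* If a is not an arc then toggle a is the identity. *)
Definition toggle n (a : 'I_n * 'I_n) (P : NC n) : NC n :=
  exist _ (toggle_set a (val P)) (toggle_set_noncrossing a (valP P)).

Lemma toggleK n (a : 'I_n * 'I_n) : involutive (@toggle n a).
Proof.
move=> P; apply: val_inj; rewrite /= /toggle_set.
have [aP | aNP] := boolP (a \in val P).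
  by rewrite setD11 setD1K // (valP P).
have [ncaP | ncNaP] := boolP (noncrossing (a |: val P)).
  by rewrite setU11 setU1K.
by rewrite (negbTE aNP) (negbTE ncNaP).
Qed.

(* The word [:: a1; ...; am] stands for the product toggle a1 \o ... \o
   toggle am, whose rightmost factor is applied first. *)
Definition word_map n (w : seq ('I_n * 'I_n)) (P : NC n) : NC n :=
  foldr (@toggle n) P w.

Lemma word_map_inj n (w : seq ('I_n * 'I_n)) : injective (word_map w).
Proof. by elim: w => [|a w IHw] P Q //= /(inv_inj (toggleK a)) /IHw. Qed.

Definition word_perm n (w : seq ('I_n * 'I_n)) : {perm NC n} :=
  perm (@word_map_inj n w).

Definition partial_coxeter_word n (w : seq ('I_n * 'I_n)) : bool :=
  uniq w && all (@is_arc n) w.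

Definition coxeter_word n (w : seq ('I_n * 'I_n)) : bool :=
  uniq w && [forall a, (a \in w) == is_arc a].

Local Open Scope ring_scope.

Definition chi n (i j : 'I_n) (P : NC n) : int := ((i, j) \in val P)%:R.

(* The two ordinals are k and k+1. *)
Definition psi n (k : nat) (hk : (k.+1 < n)%N) (P : NC n) : int :=
  let k0 := Ordinal (ltnW hk) in
  let k1 := Ordinal hk in
  2 * chi k0 k1 P
  + \sum_(i < n | (i < k)%N) chi i k1 P
  + \sum_(j < n | (k.+1 < j)%N) chi k0 j P.

Definition mesic (X : finType) (T : {perm X}) (f : X -> int) (c : rat) : Prop :=
  forall O : {set X}, O \in porbits T ->
    (#|O|%:R)^-1 * (\sum_(x in O) f x)%:~R = c.

(* Main.v *)
Require Import Defs.
From mathcomp Require Import all_boot all_order all_algebra all_fingroup.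
From mathcomp Require Import zify ring.

(** Let e = (k,k+1), and let S consist of e and the arcs (i,k+1), i < k, and
    (k,j), j > k+1.  Exactly the arcs of S other than e are incompatible with e,
    and the arcs of S are pairwise incompatible.  Hence e is in toggle e P if and
    only if P has no arc in S, i.e. chi_e (toggle e P) + sum_(a in S) chi_a P = 1.
    Write T = u e v.  A toggle at b only affects chi_b, so for every arc a either v
    preserves chi_a, or u e does; in both cases chi_a and chi_a \o v have the same
    sum on a T-orbit.  The identity above at v P reads
    chi_e (v (T P)) + sum_(a in S) chi_a (v P) = 1, and its left-hand side has the
    same sum as psi_k on each orbit. *)

Set Implicit Arguments.
Unset Strict Implicit.
Unset Printing Implicit Defensive.

Import GRing.Theory Num.Theory.

Local Open Scope ring_scope.

Lemma noncrossingP n (P : {set 'I_n * 'I_n}) :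
  reflect ((forall a, a \in P -> is_arc a) /\
           (forall a b, a \in P -> b \in P -> a != b ->
              ~~ [|| crossing a b, left_nesting a b | right_nesting a b]))
          (noncrossing P).
Proof.
apply: (iffP andP) => -[arcP ncP]; split.
- exact/forall_inP.
- by move=> a b aP bP; move/forall_inP/(_ a aP)/forall_inP/(_ b bP)/implyP: ncP.
- exact/forall_inP.
- by apply/forall_inP => a aP; apply/forall_inP => b bP; apply/implyP/ncP.
Qed.

Lemma in_toggle_neq n (a b : 'I_n * 'I_n) (P : NC n) :
  a != b -> (a \in val (toggle b P)) = (a \in val P).
Proof.
move=> /negbTE ab; rewrite /= /toggle_set.
by do 2?case: ifP => // _; rewrite !inE ab.
Qed.

Lemma in_word_map n (a : 'I_n * 'I_n) w (P : NC n) :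
  a \notin w -> (a \in val (word_map w P)) = (a \in val P).
Proof.
elim: w => //= b w IHw; rewrite inE negb_or => /andP[ab aw].
by rewrite in_toggle_neq // IHw.
Qed.

Lemma word_map_cat n (u v : seq ('I_n * 'I_n)) (P : NC n) :
  word_map (u ++ v) P = word_map u (word_map v P).
Proof. exact: foldr_cat. Qed.

(** A permutation maps each of its orbits bijectively onto itself, so this is a reindexing. *)
Lemma sum_porbit (R : nmodType) (X : finType) (s : {perm X}) (O : {set X})
    (f : X -> R) :
  O \in porbits s -> \sum_(x in O) f (s x) = \sum_(x in O) f x.
Proof.
case/imsetP => x0 _ ->; rewrite [RHS](reindex_inj (@perm_inj _ s)).
apply: eq_bigl => x; rewrite -!eq_porbit_mem.
by have := porbit_perm s 1 x; rewrite expg1 => ->.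
Qed.

(** Turns the two sums in [psi] into existence tests, so that the short-arc identity becomes a case
    analysis. *)
Lemma sum_at_most_one (R : pzSemiRingType) (I : finType) (A B : pred I) :
  (forall i j, A i -> B i -> A j -> B j -> i = j) ->
  \sum_(i | A i) (B i)%:R = ([exists i, A i && B i])%:R :> R.
Proof.
move=> uniqB; case: existsP => [[i /andP[Ai Bi]] | noB].
  rewrite (bigD1 i) //= Bi big1 ?addr0 // => j /andP[Aj /negP ji].
  case Bj: (B j) => //; case: ji; apply/eqP; exact: uniqB.
rewrite big1 // => i Ai; case Bi: (B i) => //.
by case: noB; exists i; rewrite Ai.
Qed.

Section ShortArc.

Variables (n k : nat) (hk : (k.+1 < n)%N).

Let k0 := Ordinal (ltnW hk).
Let k1 := Ordinal hk.

Lemma chi_toggle_short_arc (P : NC n) :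
  chi k0 k1 (toggle (k0, k1) P) + chi k0 k1 P
    + \sum_(i < n | (i < k)%N) chi i k1 P
    + \sum_(j < n | (k.+1 < j)%N) chi k0 j P = 1.
Proof.
have /noncrossingP[arcP ncP] := valP P.
(* Arcs of S exclude each other: [lr] by crossing, [ll] by right nesting, [rr] by left nesting. The
   last two put no bound on the free endpoint, so they also cover e. *)
have lr (i j : 'I_n) : (i < k)%N -> (k.+1 < j)%N ->
    (i, k1) \in val P -> (k0, j) \in val P -> False.
  move=> ik kj iP jP; have := ncP _ _ iP jP.
  rewrite /crossing /left_nesting /right_nesting xpair_eqE -!val_eqE /=; lia.
have ll (i i' : 'I_n) : (i, k1) \in val P -> (i', k1) \in val P -> i = i'.
  move=> iP jP; have := ncP _ _ iP jP; have := ncP _ _ jP iP.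
  have := arcP _ iP; have := arcP _ jP; rewrite /is_arc /=.
  rewrite /crossing /left_nesting /right_nesting !xpair_eqE -!val_eqE /=.
  by move=> *; apply/val_inj => /=; lia.
have rr (j j' : 'I_n) : (k0, j) \in val P -> (k0, j') \in val P -> j = j'.
  move=> iP jP; have := ncP _ _ iP jP; have := ncP _ _ jP iP.
  have := arcP _ iP; have := arcP _ jP; rewrite /is_arc /=.
  rewrite /crossing /left_nesting /right_nesting !xpair_eqE -!val_eqE /=.
  by move=> *; apply/val_inj => /=; lia.
rewrite /chi !sum_at_most_one; last 2 first.
- by move=> i j _ iP _; apply: rr.
- by move=> i j _ iP _; apply: ll.
rewrite /= /toggle_set; have [eP | eNP] := boolP ((k0, k1) \in val P).
  rewrite setD11; case: existsP => [[i /andP[ik /ll/(_ eP) ii]] | _].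
    by move: ik; rewrite ii /=; lia.
  case: existsP => [[j /andP[kj /rr/(_ eP) jj]] | _]; last by rewrite /=; ring.
  by move: kj; rewrite jj /=; lia.
(* Now e is not in P. Any other arc of S in P nests with e, so the toggle fixes P. *)
case: existsP => [[i /andP[ik iP]] | noL].
  case: existsP => [[j /andP[kj jP]] | _]; first by case: (lr i j).
  case: ifP => [/noncrossingP[_ /(_ (i, k1) (k0, k1))] | _].
    rewrite !inE iP orbT eqxx /= xpair_eqE -!val_eqE => /(_ isT isT).
    by rewrite /crossing /left_nesting /right_nesting -!val_eqE /=; lia.
  by rewrite (negbTE eNP) /=; ring.
case: existsP => [[j /andP[kj jP]] | noR].
  case: ifP => [/noncrossingP[_ /(_ (k0, k1) (k0, j))] | _].
    rewrite !inE jP orbT eqxx /= xpair_eqE -!val_eqE => /(_ isT isT).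
    by rewrite /crossing /left_nesting /right_nesting -!val_eqE /=; lia.
  by rewrite (negbTE eNP) /=; ring.
suff -> : noncrossing ((k0, k1) |: val P) by rewrite setU11 /=; ring.
apply/noncrossingP; split=> [a | [a1 a2] [b1 b2]].
  by rewrite !inE => /orP[/eqP-> | /arcP//]; rewrite /is_arc /=.
(* Nothing lies strictly between k and k+1, so only left nesting can occur with e first, and only
   right nesting with e second; [noR] and [noL] exclude these. *)
rewrite !inE => /orP[/eqP[-> ->] | aP] /orP[/eqP[-> ->] | bP].
- by rewrite eqxx.
- move=> _; have bR : ~~ ((b1 == k0) && (k.+1 < b2)%N).
    by apply/andP => -[/eqP b1k kb]; apply: noR; exists b2; rewrite kb -b1k bP.
  move: bR; rewrite /crossing /left_nesting /right_nesting -!val_eqE /=; lia.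
- move=> _; have aL : ~~ ((a2 == k1) && (a1 < k)%N).
    by apply/andP => -[/eqP a2k ak]; apply: noL; exists a1; rewrite ak -a2k aP.
  move: aL; rewrite /crossing /left_nesting /right_nesting -!val_eqE /=; lia.
- exact: ncP.
Qed.

End ShortArc.

Lemma sum_chi_word_map n (u v : seq ('I_n * 'I_n)) (O : {set NC n}) i j :
  uniq (u ++ v) -> O \in porbits (word_perm (u ++ v)) ->
  \sum_(P in O) chi i j (word_map v P) = \sum_(P in O) chi i j P.
Proof.
rewrite cat_uniq => /and3P[_ /hasPn uv _] OT.
have [ijv | ijv] := boolP ((i, j) \in v); last first.
  by apply: eq_bigr => P _; rewrite /chi in_word_map.
(* An arc of [v] is not in [u], so its indicator agrees at v P and at T P. *)
rewrite -[RHS](sum_porbit _ OT); apply: eq_bigr => P _.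
by rewrite permE word_map_cat /chi (in_word_map _ (uv _ ijv)).
Qed.

Lemma sum_psi_porbit n k (hk : (k.+1 < n)%N) (w : seq ('I_n * 'I_n))
    (O : {set NC n}) :
  uniq w -> (Ordinal (ltnW hk), Ordinal hk) \in w ->
  O \in porbits (word_perm w) ->
  \sum_(P in O) psi hk P = #|O|%:R.
Proof.
rewrite /psi /=; set k0 := Ordinal (ltnW hk); set k1 := Ordinal hk.
move=> + /splitPr w_uv; case: w_uv => u v Uw OT.
have chi_v i j :
    \sum_(P in O) chi i j P = \sum_(P in O) chi i j (word_map v P).
  (* Grouping e with the left factor leaves [v] as what acts before e is toggled. *)
  by rewrite (@sum_chi_word_map _ (u ++ [:: (k0, k1)]) v) // -catA.
have chi_vs (A : pred 'I_n) (f g : 'I_n -> 'I_n) :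
    \sum_(P in O) \sum_(i | A i) chi (f i) (g i) P
    = \sum_(P in O) \sum_(i | A i) chi (f i) (g i) (word_map v P).
  by rewrite exchange_big [RHS]exchange_big; apply: eq_bigr => i _; apply: chi_v.
have chi_T : \sum_(P in O) chi k0 k1 P
    = \sum_(P in O) chi k0 k1 (toggle (k0, k1) (word_map v P)).
  rewrite -(sum_porbit _ OT); apply: eq_bigr => P _.
  rewrite permE word_map_cat /chi in_word_map //.
  by move: Uw; rewrite uniq_catC /= mem_cat negb_or => /andP[/andP[]].
(* The coefficient 2 is split: one copy of the indicator of e is read just after its toggle, the
   other just before. *)
rewrite !big_split /= -big_distrr /= mulr_natl mulr2n {1}chi_T chi_v.
rewrite (chi_vs _ id (fun=> k1)) (chi_vs _ (fun=> k0) id).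
rewrite -!big_split /= (eq_bigr (fun=> 1)) ?sumr_const // => P _.
exact: chi_toggle_short_arc.
Qed.

Local Close Scope ring_scope.

Theorem theorem6p6 (n k : nat) (hk : k.+1 < n) (w : seq ('I_n * 'I_n)) :
  coxeter_word w \/
  (partial_coxeter_word w /\ (Ordinal (ltnW hk), Ordinal hk) \in w) ->
  mesic (word_perm w) (psi hk) 1%R.
Proof.
move=> w_cox O OT.
have [Uw kw] : uniq w /\ (Ordinal (ltnW hk), Ordinal hk) \in w.
  case: w_cox => [/andP[Uw /forallP wE] | [/andP[Uw _] kw]]; split=> //.
  by rewrite (eqP (wE _)) /is_arc /=.
(* Cancelling [#|O|] requires the orbit to be nonempty; it contains its base point. *)
rewrite (sum_psi_porbit Uw kw OT) rmorph_nat mulVf // pnatr_eq0 -lt0n card_gt0.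
by case/imsetP: OT => P _ ->; apply/set0Pn; exists P; apply: porbit_id.
Qed.
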